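(* Let $k$ be a field and $G$ a (totally) ordered abelian group. Let $R\subseteq \mathrm{LRS}(k,G)$ be non-empty. Suppose that for any $r_1,r_2\in R$, all non-trivial $a,b\in \mathrm{LRS}(k,G)$ with $\mathrm{dom}(a)=\mathrm{dom}(r_1)$ and $\mathrm{dom}(b)=\mathrm{dom}(r_1)+\mathrm{dom}(r_2)$ are also elements of $R$. Then $\langle R\rangle$ is a subfield of $k((G))$ containing $k$.
   Context: $k((G))$ denotes the field of generalised power series: all functions $s\colon G\to k$, written $s=\sum_{g\in G}s_gt^g$, whose support $\mathrm{supp}(s)=\{g\in G\mid s_g\neq 0\}$ is a well-ordered subset of $G$, with pointwise addition and product $sp=\sum_{g}\left(\sum_{h}s_hp_{g-h}\right)t^g$. The field $k$ is identified with the constants $ct^0$. For $A,B\subseteq G$, $A+B=\{a+b\mid a\in A,b\in B\}$. A (generalised) linear recurrence sequence is a partial function $r\colon G\rightharpoonup k$ whose domain $\mathrm{dom}(r)$ is a well-ordered subset of $G$; $\mathrm{LRS}(k,G)$ is the set of all of them. $r$ is trivial if $r(g)=0$ for all $g\in\mathrm{dom}(r)$, and non-trivial otherwise. For $r\in\mathrm{LRS}(k,G)$, $\langle r\rangle\subseteq k((G))$ is the set of all $s\in k((G))$ such that for every $h\in G\setminus\mathrm{dom}(r)$ one has $\sum_{g\in\mathrm{dom}(r)}r(g)s_{h-g}=0$ (the sum has only finitely many non-zero terms). For $R\subseteq\mathrm{LRS}(k,G)$, $\langle R\rangle=\bigcup_{r\in R}\langle r\rangle$. *)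

(* Defs.v *)
From HB Require Import structures.
From mathcomp Require Import all_boot all_order all_algebra.
From mathcomp Require Import boolp classical_sets functions cardinality fsbigop.
From mathcomp Require wochoice.

Set Implicit Arguments.
Unset Strict Implicit.
Unset Printing Implicit Defensive.

Import Order.TTheory GRing.Theory.

Local Open Scope classical_set_scope.
Local Open Scope ring_scope.

(* Totally ordered abelian groups: MathComp's [porderZmodType] requires neither
   totality nor the compatibility of the order with the addition.  Totality is
   an axiom here instead of being inherited from [orderType], as Hierarchy
   Builder admits no join of [orderType] and [zmodType] below the existing
   [realDomainType]. *)
HB.mixin Record POrderedZmodule_isOrdered G of Num.POrderedZmodule G := {
  ozle_total : total (<=%R : rel G);
  ozlerD2l_subproof : forall x y z : G, x <= y -> z + x <= z + y
}.

#[short(type="orderedZmodType")]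
HB.structure Definition OrderedZmodule :=
  { G of Num.POrderedZmodule G & POrderedZmodule_isOrdered G }.

Section OrderedGroup.
Context {G : orderedZmodType}.
Implicit Types x y z : G.

Lemma ozleNgt x y : (x <= y) = ~~ (y < x).
Proof. by apply: comparable_leNgt; apply: ozle_total. Qed.

Lemma ozltNge x y : (x < y) = ~~ (y <= x).
Proof. by rewrite ozleNgt negbK. Qed.

Lemma ozlerD2l z x y : (z + x <= z + y) = (x <= y).
Proof.
apply/idP/idP => [|]; last exact: ozlerD2l_subproof.
by move=> /(@ozlerD2l_subproof G _ _ (- z)); rewrite !addKr.
Qed.

Lemma ozlerD2r z x y : (x + z <= y + z) = (x <= y).
Proof. by rewrite !(addrC _ z) ozlerD2l. Qed.

Lemma ozltrD2l z x y : (z + x < z + y) = (x < y).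
Proof. by rewrite !ozltNge ozlerD2l. Qed.

Lemma ozltrD2r z x y : (x + z < y + z) = (x < y).
Proof. by rewrite !ozltNge ozlerD2r. Qed.

End OrderedGroup.

Section WellOrdered.
Context {G : orderedZmodType}.
Implicit Types A B C : set G.

Definition well_ordered A := wochoice.wo_chain (<=%R : rel G) [in A].

Lemma well_orderedP A : well_ordered A <->
  forall C, C `<=` A -> C !=set0 -> exists2 m, C m & forall x, C x -> m <= x.
Proof.
split=> [wA C CA [c Cc]|wA].
  have [|m [[mC mle] _]] := wA [in C] _ (ex_intro _ c (mem_set Cc)).
    by move=> x; rewrite !inE => /CA.
  by exists m => [|x Cx]; [exact: set_mem | apply: mle; apply: mem_set].
apply: wochoice.antisymmetric_wo_chain.
  by move=> x y _ _; apply: le_anti.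
move=> P PA [c cP].
have [|| m Pm mle] := wA [set x | x \in P].
- by move=> x /= /PA; rewrite inE.
- by exists c.
by exists m; split=> // x /mle.
Qed.

Lemma well_ordered_sub A B : A `<=` B -> well_ordered B -> well_ordered A.
Proof.
move=> AB /well_orderedP wB; apply/well_orderedP => C CA; apply: wB.
exact: subset_trans AB.
Qed.

Lemma well_ordered0 : well_ordered set0.
Proof. by apply/well_orderedP => C C0 [c /C0]. Qed.

Lemma well_ordered1 x : well_ordered [set x].
Proof.
apply/well_orderedP => C Cx [c Cc]; exists c => // y /Cx ->.
by rewrite (Cx _ Cc).
Qed.

Lemma well_orderedU A B :
  well_ordered A -> well_ordered B -> well_ordered (A `|` B).
Proof.
move=> /well_orderedP wA /well_orderedP wB; apply/well_orderedP => C CAB C0.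
have [[a [Ca Aa]]|nA] := pselect (exists a, C a /\ A a); last first.
  apply: wB => // x Cx; case: (CAB _ Cx) => // Ax.
  by exfalso; apply: nA; exists x.
have [[b [Cb Bb]]|nB] := pselect (exists b, C b /\ B b); last first.
  apply: wA => // x Cx; case: (CAB _ Cx) => // Bx.
  by exfalso; apply: nB; exists x.
have [|| m1 [Cm1 Am1] m1P] := wA (C `&` A).
- by move=> ? [].
- by exists a.
have [|| m2 [Cm2 Bm2] m2P] := wB (C `&` B).
- by move=> ? [].
- by exists b.
have [le12|le21] := orP (ozle_total m1 m2).
  exists m1 => // x Cx; case: (CAB _ Cx) => [Ax|Bx]; first exact: m1P.
  by apply: le_trans le12 _; apply: m2P.
exists m2 => // x Cx; case: (CAB _ Cx) => [Ax|Bx]; last exact: m2P.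
by apply: le_trans le21 _; apply: m1P.
Qed.

Lemma well_orderedD A B : well_ordered A -> well_ordered B ->
  well_ordered [set a + b | a in A & b in B].
Proof.
move=> /well_orderedP wA /well_orderedP wB; apply/well_orderedP => C CAB C0.
pose below x := [set a | A a /\ exists b, [/\ B b, C (a + b) & a + b <= x]].
have below_min x : C x -> exists a b, [/\ A a, B b, C (a + b), a + b <= x &
    forall a', below x a' -> a <= a'].
  move=> Cx; have [|| a [Aa [b [Bb Cab abx]]] aP] := wA (below x).
  - by move=> ? [].
  - have [a Aa [b Bb abE]] := CAB _ Cx.
    by exists a; split=> //; exists b; rewrite abE; split.
  by exists a, b; split.
pose Q b := B b /\ exists a, [/\ A a, C (a + b) &
  forall a', below (a + b) a' -> a <= a'].
have [|| b [Bb [a [Aa Cab aP]]] bP] := wB Q.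
- by move=> ? [].
- have [c Cc] := C0; have [a [b [Aa Bb Cab abc aP]]] := below_min _ Cc.
  exists b; split=> //; exists a; split=> // a' [Aa' [b' [Bb' Cab' lab']]].
  apply: aP; split=> //; exists b'; split=> //; exact: le_trans abc.
exists (a + b) => // c Cc; rewrite ozleNgt; apply/negP => cab.
have [a' [b' [Aa' Bb' Cab' abc' aP']]] := below_min _ Cc.
have lab : a' + b' < a + b by apply: le_lt_trans abc' cab.
have aa' : a <= a'.
  by apply: aP; split=> //; exists b'; split=> //; apply: ltW.
have : b <= b'.
  apply: bP; split=> //; exists a'; split=> // d [Ad [e [Be Cde lde]]].
  apply: aP'; split=> //; exists e; split=> //; exact: le_trans abc'.
rewrite ozleNgt => /negP; apply; rewrite -(ozltrD2l a).
by apply: le_lt_trans lab; rewrite ozlerD2r.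
Qed.

Lemma well_ordered_finite A : well_ordered A ->
    (forall C, C `<=` A -> C !=set0 -> exists2 m, C m & forall x, C x -> x <= m) ->
  finite_set A.
Proof.
move=> /well_orderedP wA dA; apply: contrapT => infA.
have [A0|/set0P A0] := eqVneq A set0; first by apply: infA; rewrite A0.
have [M AM MP] := dA A (@subset_refl _ _) A0.
pose B := [set x | A x /\ ~ finite_set (A `&` [set y | y <= x])].
have [||m [Am infm] mP] := wA B.
- by move=> ? [].
- exists M; split=> // fin; apply: infA; apply: sub_finite_set fin.
  by move=> x Ax; split=> //; apply: MP.
have [E|/set0P N0] := eqVneq (A `&` [set y | y < m]) set0.
  apply: infm; apply: sub_finite_set (finite_set1 m) => x [Ax /= xm].
  apply: contrapT => xNm; have : (A `&` [set y | y < m]) x.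
    by split=> //=; rewrite lt_neqAle xm andbT; apply/eqP.
  by rewrite E.
have [|m' [Am' m'm] m'P] := dA _ _ N0; first by move=> ? [].
have finm' : finite_set (A `&` [set y | y <= m']).
  apply: contrapT => inf; have /mP : B m' by [].
  by rewrite ozleNgt m'm.
apply: infm; have : finite_set ((A `&` [set y | y <= m']) `|` [set m]).
  by rewrite finite_setU; split.
apply: sub_finite_set => x [Ax /= xm].
have [->|xNm] := eqVneq x m; first by right.
left; split=> //=; apply: m'P; split=> //=.
by rewrite lt_neqAle xNm.
Qed.

Lemma well_ordered_finite_fiber A B g : well_ordered A -> well_ordered B ->
  finite_set (A `&` [set h | B (g - h)]).
Proof.
move=> wA wB; apply: well_ordered_finite.
  by apply: well_ordered_sub wA => ? [].
move=> C CAB [c Cc]; move/well_orderedP: wB => wB.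
have [||m' [m Cm <-] mP] := wB [set g - h | h in C].
- by move=> _ [h /CAB [_ ?] <-].
- by exists (g - c), c.
exists m => // x Cx.
have := mP _ (ex_intro2 _ _ x Cx erefl).
by rewrite ozlerD2l -(ozlerD2l (x + m)) addrK [x + m]addrC addrK.
Qed.

End WellOrdered.

Arguments well_ordered1 {G} x.

Record hahn (k : fieldType) (G : orderedZmodType) := Hahn {
  coef :> G -> k;
  coef_wo : well_ordered [set g | coef g != 0]
}.

Definition hsupp (k : fieldType) (G : orderedZmodType) (s : hahn k G) : set G :=
  [set g | s g != 0].

HB.instance Definition _ k G := gen_eqMixin (hahn k G).
HB.instance Definition _ k G := gen_choiceMixin (hahn k G).

Section HahnField.
Context {k : fieldType} {G : orderedZmodType}.
Implicit Types (s p q : hahn k G) (g h : G).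

Lemma hsupp_wo s : well_ordered (hsupp s). Proof. exact: coef_wo. Qed.
Arguments hsupp_wo : clear implicits.

Lemma hahnP s p : s =1 p -> s = p.
Proof.
case: s p => [s ws] [p wp] /= /funext sp.
by move: wp; rewrite -sp => wp; rewrite (Prop_irrelevance ws wp).
Qed.

Fact zero_wo : well_ordered [set g : G | (0 : k) != 0].
Proof. by apply: well_ordered_sub well_ordered0 => g /=; rewrite eqxx. Qed.

Definition hzero : hahn k G := Hahn zero_wo.

Fact opp_wo s : well_ordered [set g | - s g != 0].
Proof. by apply: well_ordered_sub (hsupp_wo s) => g /=; rewrite oppr_eq0. Qed.
Arguments opp_wo : clear implicits.

Definition hopp s : hahn k G := Hahn (opp_wo s).

Fact add_wo s p : well_ordered [set g | s g + p g != 0].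
Proof.
apply: well_ordered_sub (well_orderedU (hsupp_wo s) (hsupp_wo p)) => g /= nz.
have [s0|] := eqVneq (s g) 0; last by left.
by right; move: nz; rewrite s0 add0r.
Qed.
Arguments add_wo : clear implicits.

Definition hadd s p : hahn k G := Hahn (add_wo s p).

Fact haddA : associative hadd.
Proof. by move=> s p q; apply: hahnP => g; apply: addrA. Qed.
Fact haddC : commutative hadd.
Proof. by move=> s p; apply: hahnP => g; apply: addrC. Qed.
Fact hadd0 : left_id hzero hadd.
Proof. by move=> s; apply: hahnP => g; apply: add0r. Qed.
Fact haddN : left_inverse hzero hopp hadd.
Proof. by move=> s; apply: hahnP => g; apply: addNr. Qed.

HB.instance Definition _ := GRing.isZmodule.Build (hahn k G)
  haddA haddC hadd0 haddN.

(* [\sum_(h \in A) F h] is the sum of the non-zero terms, with value 0 if there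
   are infinitely many of them; [fiber_fin] excludes that case. *)
Definition conv s p g : k := \sum_(h \in [set: G]) s h * p (g - h).

Lemma fiber_fin s p g : finite_set (hsupp s `&` [set h | hsupp p (g - h)]).
Proof. exact: well_ordered_finite_fiber (hsupp_wo s) (hsupp_wo p). Qed.

Lemma conv_restrict s p g A :
    hsupp s `&` [set h | hsupp p (g - h)] `<=` A ->
  conv s p g = \sum_(h \in A) s h * p (g - h).
Proof.
move=> sA; apply/esym/fsbig_widen => // h [_ /= nAh].
have [->|sh] := eqVneq (s h) 0; first by rewrite mul0r.
have [->|ph] := eqVneq (p (g - h)) 0; first by rewrite mulr0.
by exfalso; apply: nAh; apply: sA.
Qed.

Lemma conv_neq0 s p g : conv s p g != 0 ->
  exists h, s h != 0 /\ p (g - h) != 0.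
Proof.
move=> nz; apply: contrapT => N; move/eqP: nz; apply; apply: fsbig1 => h _.
apply: contrapT => /eqP; rewrite mulf_eq0 negb_or => /andP[sh ph].
by apply: N; exists h.
Qed.

Fact conv_wo s p : well_ordered [set g | conv s p g != 0].
Proof.
apply: well_ordered_sub (well_orderedD (hsupp_wo s) (hsupp_wo p)) => g /=.
by move=> /conv_neq0[h [sh ph]]; exists h => //; exists (g - h) => //; rewrite subrKC.
Qed.
Arguments conv_wo : clear implicits.

Definition hmul s p : hahn k G := Hahn (conv_wo s p).

Lemma hmulC : commutative hmul.
Proof.
move=> s p; apply: hahnP => g /=; rewrite /conv.
rewrite (reindex_fsbigT (fun h => g - h)); last first.
  by exists (fun h => g - h) => h; rewrite subKr.
by apply: eq_fsbigr => h _; rewrite subKr mulrC.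
Qed.

Lemma hmulDl : left_distributive hmul hadd.
Proof.
move=> s p q; apply: hahnP => g /=.
pose A := (hsupp s `|` hsupp p) `&` [set h | hsupp q (g - h)].
have finA : finite_set A.
  apply: well_ordered_finite_fiber (hsupp_wo q).
  exact: well_orderedU (hsupp_wo s) (hsupp_wo p).
have resA r : hsupp r `<=` hsupp s `|` hsupp p ->
    conv r q g = \sum_(h \in A) r h * q (g - h).
  by move=> rsp; apply: conv_restrict => h [/rsp].
rewrite !resA => [|h|h|h /= nz]; last first.
- have [s0|] := eqVneq (s h) 0; last by left.
  by right; move: nz; rewrite /hsupp /= s0 add0r.
- by left.
- by right.
by rewrite -fsbig_split//; apply: eq_fsbigr => h _; rewrite mulrDl.
Qed.

Lemma hmulA : associative hmul.
Proof.
move=> s p q; apply: hahnP => g /=.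
pose SP := [set a + b | a in hsupp s & b in hsupp p].
pose PQ := [set a + b | a in hsupp p & b in hsupp q].
have wSP : well_ordered SP := well_orderedD (hsupp_wo s) (hsupp_wo p).
have wPQ : well_ordered PQ := well_orderedD (hsupp_wo p) (hsupp_wo q).
pose A' := hsupp s `&` [set h | PQ (g - h)].
pose B := SP `&` [set m | hsupp q (g - m)].
have finA : finite_set A' := well_ordered_finite_fiber g (hsupp_wo s) wPQ.
have finB : finite_set B := well_ordered_finite_fiber g wSP (hsupp_wo q).
have inAB h m : s h != 0 -> p (m - h) != 0 -> q (g - m) != 0 -> A' h /\ B m.
  move=> sh pm qg; split; split=> //=.
    exists (m - h) => //; exists (g - m) => //.
    by rewrite addrC addrA subrK.
  by exists h => //; exists (m - h) => //; rewrite subrKC.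
transitivity (\sum_(h \in A') \sum_(m \in B) s h * p (m - h) * q (g - m)).
  rewrite (@conv_restrict _ _ _ A'); last first.
    move=> h [sh /= /conv_neq0[l [pl ql]]]; split=> //=.
    by exists l => //; exists (g - h - l) => //; rewrite subrKC.
  apply: eq_fsbigr => h _ /=; rewrite mulr_fsumr.
  rewrite (reindex_fsbigT (fun m => m - h)); last first.
    by exists (fun m => m + h) => m; rewrite ?subrK ?addrK.
  apply/esym; rewrite (@fsbig_widen _ _ _ _ B setT)//.
    by apply: eq_fsbigr => m _; rewrite mulrA opprB addrA subrK.
  move=> m [_ /= nB]; apply: contrapT => /eqP.
  rewrite !mulf_eq0 !negb_or -!andbA => /and3P[sh pm qg]; apply: nB.
  by have [] := inAB h m.
rewrite exchange_fsbig//.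
rewrite (@conv_restrict _ _ _ B); last first.
  move=> m [/= /conv_neq0[h [sh pm]] qm]; split=> //.
  by exists h => //; exists (m - h) => //; rewrite subrKC.
apply: eq_fsbigr => m _ /=; rewrite mulr_fsuml.
apply: fsbig_widen => // h [_ /= nA]; apply: contrapT => /eqP.
rewrite !mulf_eq0 !negb_or -!andbA => /and3P[sh pm qg]; apply: nA.
by have [] := inAB h m.
Qed.

Fact const_wo (c : k) : well_ordered [set g : G | (if g == 0 then c else 0) != 0].
Proof.
apply: well_ordered_sub (well_ordered1 0) => g /=.
by have [->|_] := eqVneq g 0; rewrite ?eqxx.
Qed.
Arguments const_wo : clear implicits.

(* The constant series [c t^0]. *)
Definition hconst c : hahn k G := Hahn (const_wo c).

Lemma hmul_constE c s g : hmul (hconst c) s g = c * s g.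
Proof.
rewrite /= (@conv_restrict _ _ _ [set 0]); last first.
  by move=> h [/=]; rewrite /hsupp /=; have [->|_] := eqVneq h 0; rewrite ?eqxx.
by rewrite fsbig_set1 /= eqxx subr0.
Qed.

Lemma hmul1 : left_id (hconst 1) hmul.
Proof. by move=> s; apply: hahnP => g; rewrite hmul_constE mul1r. Qed.

Lemma hone_neq0 : hconst 1 != 0.
Proof.
apply/eqP => /(congr1 (fun s : hahn k G => s 0)) /= /eqP.
by rewrite eqxx oner_eq0.
Qed.

HB.instance Definition _ := GRing.Zmodule_isComNzRing.Build (hahn k G)
  hmulA hmulC hmul1 hmulDl hone_neq0.

Lemma hadd_coef s p g : (s + p) g = s g + p g. Proof. by []. Qed.
Lemma hopp_coef s g : (- s) g = - s g. Proof. by []. Qed.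
Lemma hzero_coef g : (0 : hahn k G) g = 0. Proof. by []. Qed.
Lemma hone_coef g : (1 : hahn k G) g = (g == 0)%:R.
Proof. by rewrite [LHS]/=; case: eqP. Qed.
Lemma hmul_coef s p g : (s * p) g = \sum_(h \in [set: G]) s h * p (g - h).
Proof. by []. Qed.

Lemma hleading s : s != 0 ->
  exists2 v, s v != 0 & forall g, s g != 0 -> v <= g.
Proof.
move=> s0; have /well_orderedP := hsupp_wo s; apply=> //.
apply: contrapT => E; move/eqP: s0; apply; apply: hahnP => g.
by apply: contrapT => /eqP sg; apply: E; exists g.
Qed.

(* Coefficients of a product up to the sum of two lower bounds. *)
Lemma hmul_lt s p v w g : (forall h, s h != 0 -> v <= h) ->
  (forall h, p h != 0 -> w <= h) -> g < v + w -> (s * p) g = 0.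
Proof.
move=> vP wP gvw; apply: contrapT => /eqP /conv_neq0 [h [sh ph]].
have : v + w <= g.
  rewrite -[g](subrKC h); apply: le_trans (_ : v + (g - h) <= _).
    by rewrite ozlerD2l; apply: wP.
  by rewrite ozlerD2r; apply: vP.
by rewrite ozleNgt gvw.
Qed.

Lemma hmul_lead s p v w : (forall h, s h != 0 -> v <= h) ->
  (forall h, p h != 0 -> w <= h) -> (s * p) (v + w) = s v * p w.
Proof.
move=> vP wP; rewrite [LHS](@conv_restrict _ _ _ [set v]).
  by rewrite fsbig_set1 [v + w]addrC addrK.
move=> h [/= sh ph]; apply: le_anti; rewrite vP// andbT.
by have := wP _ ph; rewrite -(ozlerD2r h) subrK [w + h]addrC ozlerD2r.
Qed.

(* Call [p] partial if [s * p] agrees with 1 up to [v + h] for all [h] in the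
   support of [p].  Any two partial series agree on a common initial segment;
   gluing all of them gives a series that cannot be extended, hence an inverse
   of [s]. *)
Section Inverse.
Variables (s : hahn k G) (v : G).
Hypotheses (sv : s v != 0) (vP : forall g, s g != 0 -> v <= g).

Let partial p := forall h, p h != 0 -> forall g, g <= v + h ->
  (s * p) g = (1 : hahn k G) g.

Let partial_eq p q h h' : partial p -> partial q -> p h != 0 -> q h' != 0 ->
  forall g, g <= h -> g <= h' -> p g = q g.
Proof.
move=> Pp Pq ph qh g gh gh'; apply: contrapT => /eqP; rewrite -subr_eq0 => pqg.
have pq0 : p - q != 0.
  by apply/eqP => /(congr1 (fun r : hahn k G => r g)) /= /eqP; exact/negP.
have [w pqw wP] := hleading pq0.
have wg : w <= g by apply: wP.
have := hmul_lead vP wP; rewrite mulrBr [LHS]hadd_coef hopp_coef.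
rewrite (Pp _ ph) ?ozlerD2l; last exact: le_trans gh.
rewrite (Pq _ qh) ?ozlerD2l; last exact: le_trans gh'.
by rewrite subrr => /esym /eqP; rewrite mulf_eq0 (negbTE sv) (negbTE pqw).
Qed.

Let reach p g := partial p /\ exists2 h, p h != 0 & g <= h.

Let Pcoef g : k := if pselect (exists p, reach p g) is left e
  then projT1 (cid e) g else 0.

Let PcoefE p g : reach p g -> Pcoef g = p g.
Proof.
move=> rp; rewrite /Pcoef; case: pselect => [e|]; last by case; exists p.
case: cid => q /= [Pq [h' qh' gh']]; case: rp => Pp [h ph gh].
exact: (partial_eq Pq Pp qh' ph).
Qed.

Let Pcoef_reach g : Pcoef g != 0 -> exists p, reach p g.
Proof. by rewrite /Pcoef; case: pselect => //; rewrite eqxx. Qed.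

Let P_wo : well_ordered [set g | Pcoef g != 0].
Proof.
apply/well_orderedP => C CP [c Cc].
have [p rp] := Pcoef_reach (CP _ Cc).
have [Pp [h ph ch]] := rp.
have /well_orderedP wp := hsupp_wo p.
have down g : g <= c -> reach p g.
  by move=> gc; split=> //; exists h => //; apply: le_trans ch.
have [|| m [Cm mc] mP] := wp (C `&` [set g | g <= c]).
- by move=> g [Cg /= gc]; rewrite /hsupp /= -(PcoefE (down _ gc)); apply: CP.
- by exists c; split=> /=.
exists m => // x Cx; have [xc|cx] := orP (ozle_total x c); first exact: mP.
exact: le_trans cx.
Qed.

Let P := Hahn P_wo.

Let mul_agree p q w : (forall g, g <= w -> p g = q g) ->
  forall g, g <= v + w -> (s * p) g = (s * q) g.
Proof.
move=> pq g gw; apply: eq_fsbigr => h _.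
have [->|sh] := eqVneq (s h) 0; first by rewrite !mul0r.
congr (_ * _); apply: pq; rewrite -(ozlerD2l h) subrKC.
by apply: le_trans gw _; rewrite ozlerD2r; apply: vP.
Qed.

Let P_partial : partial P.
Proof.
move=> h /Pcoef_reach [p rp] g gh; have [Pp [h' ph' hh']] := rp.
rewrite (@mul_agree P p h)//; last first.
  move=> g' g'h; apply: PcoefE; split=> //; exists h' => //.
  exact: le_trans hh'.
by apply: Pp ph' _ _; apply: le_trans gh _; rewrite ozlerD2l.
Qed.

Lemma hahn_inverse_exists : exists p, s * p = 1.
Proof.
exists P; apply: contrapT => /eqP; rewrite eq_sym -subr_eq0 => d0.
have [w dw wP] := hleading d0.
pose c := (1 - s * P) w / s v.
have c0 : c != 0 by rewrite mulf_neq0// invr_neq0.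
pose e := w - v.
have Pe g : P g != 0 -> g < e.
  move=> Pg; rewrite ozltNge; apply/negP => eg; move/negP: dw; apply.
  rewrite hadd_coef hopp_coef (P_partial Pg) ?subrr//.
  by rewrite -(subrKC v w) ozlerD2l.
have m_wo : well_ordered [set g | (if g == e then c else 0) != 0].
  apply: well_ordered_sub (well_ordered1 e) => g /=.
  by have [->|_] := eqVneq g e; rewrite ?eqxx.
pose m : hahn k G := Hahn m_wo.
have mP g : m g != 0 -> e <= g.
  by rewrite /=; have [->|_] := eqVneq g e; rewrite ?eqxx.
have me : m e = c by rewrite /= eqxx.
have vew : v + e = w by rewrite subrKC.
have part : partial (P + m).
  move=> h Qh g gh; have he : h <= e.
    rewrite ozleNgt; apply/negP => eh; move/negP: Qh; apply; apply/eqP.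
    rewrite hadd_coef /m /= (gt_eqF eh) addr0.
    apply: contrapT => /eqP /Pe; apply/negP.
    by rewrite -ozleNgt; apply: ltW.
  have gw : g <= w by rewrite -vew; apply: le_trans gh _; rewrite ozlerD2l.
  rewrite mulrDr hadd_coef; have [->|gNw] := eqVneq g w.
    rewrite -{2}vew (hmul_lead vP mP) me /c mulrCA divff// mulr1.
    by rewrite hadd_coef hopp_coef addrC subrK.
  rewrite (hmul_lt vP mP) ?vew ?lt_neqAle ?gNw// addr0.
  apply/esym/eqP; rewrite -subr_eq0; apply: contrapT => /negP /wP.
  by apply/negP; rewrite -ozltNge lt_neqAle gNw.
have Pe0 : P e = 0.
  by apply: contrapT => /eqP /Pe; rewrite ltxx.
have /PcoefE : reach (P + m) e.
  by split=> //; exists e => //; rewrite hadd_coef Pe0 add0r me.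
rewrite hadd_coef Pe0 add0r me => E.
by move/eqP: c0; rewrite -E.
Qed.

End Inverse.

Definition hinv s : hahn k G :=
  if pselect (exists p, s * p = 1) is left e then projT1 (cid e) else 0.

Fact hmulVr s : s != 0 -> hinv s * s = 1.
Proof.
move=> /hleading [v sv vP]; rewrite mulrC /hinv.
case: pselect => [e|[]]; first by case: cid.
exact: hahn_inverse_exists sv vP.
Qed.

Fact hinv0 : hinv 0 = 0.
Proof.
rewrite /hinv; case: pselect => // e; exfalso; case: e => p.
by rewrite mul0r => /eqP; rewrite eq_sym oner_eq0.
Qed.

HB.instance Definition _ := GRing.ComNzRing_isField.Build (hahn k G)
  hmulVr hinv0.

End HahnField.

Arguments hsupp_wo {k G} s.

Section LinearRecurrence.
Context {k : fieldType} {G : orderedZmodType}.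

(* [r g = None] encodes that the partial function [r] is undefined at [g]. *)
Record lrs := Lrs {
  lrs_fun : G -> option k;
  lrs_wo : well_ordered [set g | lrs_fun g != None]
}.
Arguments lrs_wo : clear implicits.

Definition lrs_dom (r : lrs) : set G := [set g | lrs_fun r g != None].

(* The value of [r] at [g]; the default 0 is only used outside of [lrs_dom r]. *)
Definition lrs_val (r : lrs) (g : G) : k := odflt 0 (lrs_fun r g).

Definition lrs_trivial (r : lrs) : Prop := forall g, lrs_dom r g -> lrs_val r g = 0.

Definition lrs_span (r : lrs) : set (hahn k G) :=
  [set s | forall h, ~ lrs_dom r h ->
     \sum_(g \in lrs_dom r) lrs_val r g * s (h - g) = 0].

Definition lrs_spans (R : set lrs) : set (hahn k G) :=
  \bigcup_(r in R) lrs_span r.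

(* The sums defining [lrs_span] do have finitely many non-zero terms. *)
Lemma lrs_span_fin (r : lrs) (s : hahn k G) h :
  finite_set (lrs_dom r `&` [set g | s (h - g) != 0]).
Proof. exact: well_ordered_finite_fiber (lrs_wo r) (hsupp_wo s). Qed.

End LinearRecurrence.

Arguments lrs : clear implicits.
Arguments lrs_wo {k G} l.

(* Main.v *)
(** Identify a recurrence r with the series sum_g r(g) t^g.  Then s lies in <r>
    iff the support of r s lies in D = dom(r), so when r ranges over the
    non-trivial recurrences with domain D, the sets <r> cover exactly the
    fractions p / q of series supported in D.  Sums, differences and quotients
    of fractions supported in D1 and D2 are fractions supported in D1 + D2.  If
    some r in R is trivial, <r> is the whole of k((G)). *)

Require Import Defs.
From HB Require Import structures.
From mathcomp Require Import all_boot all_order all_algebra.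
From mathcomp Require Import boolp classical_sets functions cardinality fsbigop.

Import Order.TTheory GRing.Theory.

Local Open Scope classical_set_scope.
Local Open Scope ring_scope.

Section Support.
Context {k : fieldType} {G : orderedZmodType}.
Implicit Types (s p : hahn k G) (A B : set G).

Lemma hsuppB s p A : hsupp s `<=` A -> hsupp p `<=` A -> hsupp (s - p) `<=` A.
Proof.
move=> sA pA g nz; have [s0|/sA//] := eqVneq (s g) 0.
apply: pA; have : s g - p g != 0 := nz.
by rewrite s0 add0r oppr_eq0.
Qed.

Lemma hsuppM s p A B : hsupp s `<=` A -> hsupp p `<=` B ->
  hsupp (s * p) `<=` [set x + y | x in A & y in B].
Proof.
move=> sA pB g /conv_neq0[h [sh ph]].
exists h; first exact: sA.
by exists (g - h); [exact: pB | rewrite subrKC].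
Qed.

Lemma hsupp_hconstM c s : hsupp (hconst c * s) `<=` hsupp s.
Proof.
move=> g; rewrite /hsupp /=.
have -> : conv (hconst c) s g = c * s g by exact: hmul_constE.
by rewrite mulf_eq0 negb_or => /andP[].
Qed.

End Support.

Section Fractions.
Context {k : fieldType} {G : orderedZmodType}.
Implicit Types (s p q : hahn k G) (A B : set G).

Definition fractions A : set (hahn k G) :=
  [set s | exists p q, [/\ q != 0, hsupp p `<=` A, hsupp q `<=` A & s = p / q]].

(** Write [c] as [(c * s) / s]; the series [s] only witnesses that [A] supports a non-zero
    denominator. *)
Lemma fractions_hconst A s c : s != 0 -> hsupp s `<=` A ->
  fractions A (hconst c).
Proof.
move=> s0 sA; exists (hconst c * s), s; split=> //; last by rewrite mulfK.
exact: subset_trans (hsupp_hconstM _ _) sA.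
Qed.

(** Over the common denominator, every product pairs a factor supported in [A] with one supported in
    [B]. *)
Lemma fractionsB A B s p : fractions A s -> fractions B p ->
  fractions [set x + y | x in A & y in B] (s - p).
Proof.
move=> [n1 [d1 [d1_0 n1A d1A ->]]] [n2 [d2 [d2_0 n2B d2B ->]]].
exists (n1 * d2 - d1 * n2), (d1 * d2).
split; first by rewrite mulf_neq0.
- by apply: hsuppB; exact: hsuppM.
- exact: hsuppM.
- by rewrite -mulNr addf_div// mulNr [n2 * d1]mulrC.
Qed.

Lemma fractionsV A B s p : p != 0 -> fractions A s -> fractions B p ->
  fractions [set x + y | x in A & y in B] (s / p).
Proof.
move=> p0 [n1 [d1 [d1_0 n1A d1A ->]]] [n2 [d2 [d2_0 n2B d2B pE]]].
(* In the quotient, the numerator of [p] becomes a factor of the denominator. *)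
have n2_0 : n2 != 0 by apply: contraNneq p0 => n2_0; rewrite pE n2_0 mul0r.
rewrite pE.
exists (n1 * d2), (d1 * n2).
split; first by rewrite mulf_neq0.
- exact: hsuppM.
- exact: hsuppM.
- by rewrite invf_div mulf_div.
Qed.

End Fractions.

Section RecurrenceSeries.
Context {k : fieldType} {G : orderedZmodType}.
Implicit Types (r : lrs k G) (s q : hahn k G).

Lemma lrs_val_dom r g : lrs_val r g != 0 -> lrs_dom r g.
Proof.
by rewrite /lrs_val /lrs_dom /=; case: (lrs_fun r g) => //=; rewrite eqxx.
Qed.

Fact lrs_val_wo r : well_ordered [set g | lrs_val r g != 0].
Proof. by apply: well_ordered_sub (lrs_wo r) => g; exact: lrs_val_dom. Qed.

Definition lrs_series r : hahn k G := Hahn (lrs_val_wo r).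

Lemma hsupp_lrs_series r : hsupp (lrs_series r) `<=` lrs_dom r.
Proof. by move=> g; exact: lrs_val_dom. Qed.

Lemma lrs_series_eq0 r : lrs_series r = 0 <-> lrs_trivial r.
Proof.
split=> [r0 g _|r0].
  exact (congr1 (fun s : hahn k G => s g) r0).
apply: hahnP => g; apply: contrapT => /eqP nz.
by move/eqP: (nz); apply; exact: r0 (lrs_val_dom _ _ nz).
Qed.

(** The recurrence sum at [h] is the coefficient of the product at [h]: since [lrs_val] is 0 outside
    the domain, summing over all of [G] adds only zero terms. *)
Lemma lrs_spanE r s :
  lrs_span r s <-> hsupp (lrs_series r * s) `<=` lrs_dom r.
Proof.
have sumE h : \sum_(g \in lrs_dom r) lrs_val r g * s (h - g) =
    (lrs_series r * s) h.
  apply: fsbig_widen => // g [_ /= nD].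
  by have [->|/lrs_val_dom//] := eqVneq (lrs_val r g) 0; rewrite mul0r.
split=> [rs h|rs h nD]; last first.
  by rewrite sumE; apply: contrapT => /eqP/rs.
by move=> nz; apply: contrapT => /rs; rewrite sumE; exact/eqP.
Qed.

Lemma lrs_span_trivial r s : lrs_trivial r -> lrs_span r s.
Proof.
by move=> /lrs_series_eq0 r0; apply/lrs_spanE => g; rewrite r0 mul0r /hsupp/= eqxx.
Qed.

Lemma lrs_span_fractions r s : ~ lrs_trivial r -> lrs_span r s ->
  fractions (lrs_dom r) s.
Proof.
move=> r0 /lrs_spanE rs.
have nz : lrs_series r != 0 by apply/eqP => /lrs_series_eq0.
exists (lrs_series r * s), (lrs_series r); split=> //.
  exact: hsupp_lrs_series.
by rewrite mulrAC mulfV// mul1r.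
Qed.

(** Padding [q] with explicit zeros on [A] makes the domain exactly [A], even where the support of
    [q] is smaller. *)
Lemma lrs_of_series A q : well_ordered A -> hsupp q `<=` A ->
  exists r, lrs_dom r = A /\ lrs_series r = q.
Proof.
move=> wA qA; pose f g := if g \in A then Some (q g) else None.
have fA : [set g | f g != None] = A.
  by apply/seteqP; split=> g /=; rewrite /f -[A g]in_setE; case: ifP.
have wf : well_ordered [set g | f g != None] by rewrite fA.
exists (Lrs wf); split=> //.
apply: hahnP => g; rewrite /= /lrs_val /= /f; case: ifPn => //= gA.
by apply/esym; apply: contrapT => /eqP/qA/mem_set; exact/negP.
Qed.

(** For [s = p / q], the denominator [q] serves as the recurrence, because [q * s = p] is supported
    in [A]. *)
Lemma fractions_lrs_span A s : well_ordered A -> fractions A s ->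
  exists r, [/\ ~ lrs_trivial r, lrs_dom r = A & lrs_span r s].
Proof.
move=> wA [p [q [q0 pA qA ->]]].
have [r [rA rq]] := lrs_of_series A q wA qA.
exists r; split=> //.
  by move/lrs_series_eq0; rewrite rq; exact/eqP.
by apply/lrs_spanE; rewrite rq rA mulrCA mulfV// mulr1.
Qed.

End RecurrenceSeries.

Theorem theorem3p11 (k : fieldType) (G : orderedZmodType) (R : set (lrs k G)) :
  R !=set0 ->
  (forall r1 r2 : lrs k G, R r1 -> R r2 ->
     forall a b : lrs k G, ~ lrs_trivial a -> ~ lrs_trivial b ->
       lrs_dom a = lrs_dom r1 ->
       lrs_dom b = [set x + y | x in lrs_dom r1 & y in lrs_dom r2] ->
       R a /\ R b) ->
  divring_closed [in lrs_spans R] /\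
  [set hconst c | c in [set: k]] `<=` lrs_spans R.
Proof.
move=> [r0 Rr0] closedR.
(* A trivial recurrence in [R] already spans all of [k((G))]; otherwise every element of [R] yields
   fractions. *)
have [[r [Rr triv_r]]|no_triv] := pselect (exists r, R r /\ lrs_trivial r).
  have spansT s : lrs_spans R s by exists r => //; exact: lrs_span_trivial.
  by split=> [|s _]; [split=> [|s t _ _|s t _ _]; exact: mem_set | exact: spansT].
have nontriv r : R r -> ~ lrs_trivial r by move=> Rr tr; apply: no_triv; exists r.
have spans_fractions s : lrs_spans R s ->
    exists r, R r /\ fractions (lrs_dom r) s.
  by case=> r Rr rs; exists r; split=> //; apply: lrs_span_fractions rs; exact: nontriv.
have fractions_spans r1 r2 s : R r1 -> R r2 ->
    fractions [set x + y | x in lrs_dom r1 & y in lrs_dom r2] s ->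
    lrs_spans R s.
  move=> R1 R2 /(fractions_lrs_span _ _ (well_orderedD (lrs_wo r1) (lrs_wo r2))).
  move=> [b [b0 domb bs]]; exists b => //.
  (* [r1] itself plays the role of [a]. *)
  by have [] := closedR _ _ R1 R2 r1 b (nontriv _ R1) b0 erefl domb.
have spans_const c : lrs_spans R (hconst c).
  have q0 : lrs_series r0 != 0.
    by apply/eqP => /lrs_series_eq0; exact: nontriv.
  apply: (fractions_spans r0 r0) => //.
  (* The square is a non-zero series supported in the sumset of [lrs_dom r0] with itself, the form
     of domain that [fractions_spans] accepts. *)
  apply: (fractions_hconst _ (lrs_series r0 * lrs_series r0)).
    by rewrite mulf_neq0.
  by apply: hsuppM; exact: hsupp_lrs_series.
split; last by move=> _ [c _ <-].
split=> [|s t|s t]; first exact/mem_set/spans_const.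
  rewrite !inE => /spans_fractions[r1 [R1 s1]] /spans_fractions[r2 [R2 t2]].
  by apply: (fractions_spans r1 r2) => //; exact: fractionsB.
(* Division is total with [0^-1 = 0], so this case asks that 0, a constant, lie in the span. *)
have [->|t0] := eqVneq t 0.
  move=> _ _; rewrite invr0 mulr0 inE.
  have <- : hconst 0 = 0 :> hahn k G by apply: hahnP => g /=; case: ifP.
  exact: spans_const.
rewrite !inE => /spans_fractions[r1 [R1 s1]] /spans_fractions[r2 [R2 t2]].
by apply: (fractions_spans r1 r2) => //; exact: fractionsV.
Qed.
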